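(* Let $r=p/q$, where $p$ is a complex polynomial of degree $d$ with $d$ simple roots $\lambda_1,\dots,\lambda_d$, and $q$ is a complex polynomial with $\deg q<d$ and $q(\lambda_j)\ne0$ for all $j$. Let $M\subset\mathbb{C}$ be compact and $K=r^{-1}(M)$. Let $W_c$ be the set of critical values of $r$, and put $M_0=M\setminus W_c$ and $K_0=r^{-1}(M_0)$. Then, given a function $\varphi:K_0\to\mathbb{C}$, there exists a unique function $f=(f_1,\dots,f_d):M_0\to\mathbb{C}^d$ such that $$\varphi(z)=\sum_{k=1}^d\delta_k(z)\,f_k(r(z))$$ holds for $z\in K_0$. The function $f$ inherits the smoothness of $\varphi$. In particular, if $\varphi$ is continuous or holomorphic in $K_0$, then $f$ is continuous or holomorphic, respectively, in $M_0$.
   Context: For $k=1,\dots,d$, $$\delta_k(z)=\frac{r(z)}{r'(\lambda_k)(z-\lambda_k)},$$ a rational function with the removable singularity at $z=\lambda_k$ removed (so $\delta_k(\lambda_k)=1$), defined wherever $q(z)\neq0$. For $S\subset\mathbb{C}$, $r^{-1}(S)=\{z\in\mathbb{C}: q(z)\ne0,\ r(z)\in S\}$. A critical value of $r$ is a number $r(z_c)$ with $q(z_c)\neq0$ and $r'(z_c)=0$. As a general convention, a function is called holomorphic in a compact set if it is holomorphic in some neighborhood of that set. *)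

(* Defs.v *)
From HB Require Import structures.
From mathcomp Require Import all_boot all_order all_algebra.
From mathcomp Require Import complex.
From mathcomp Require Import all_classical all_reals all_analysis.

Set Implicit Arguments.
Unset Strict Implicit.
Unset Printing Implicit Defensive.

Import Order.TTheory GRing.Theory Num.Theory.
Import numFieldNormedType.Exports.

Local Open Scope classical_set_scope.
Local Open Scope ring_scope.

(* R[i] has no topology of its own; viewed as a numClosedFieldType it receives
   the one MathComp-Analysis attaches to every numeric field, namely the metric
   topology of the modulus, and [derivable g z 1] is complex
   differentiability. *)
Definition Cplx (R : realType) : numClosedFieldType := R[i].

Section RationalFunctions.
Variable C : numClosedFieldType.
Implicit Types (p q : {poly C}) (z w : C).

(* Junk value 0 at the poles; every use below is guarded by [q.[z] != 0]. *)
Definition ratfun p q : C -> C := fun z => p.[z] / q.[z].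

Definition ratpreim p q (S : set C) : set C :=
  [set z | q.[z] != 0 /\ S (ratfun p q z)].

Definition critical_values p q : set C :=
  [set w | exists z,
     [/\ q.[z] != 0, derive1 (ratfun p q) z = 0 & ratfun p q z = w]].

Definition delta p q (l z : C) : C :=
  if z == l then 1
  else ratfun p q z / (derive1 (ratfun p q) l * (z - l)).

End RationalFunctions.

Section Regularity.
Variable C : numClosedFieldType.
Implicit Types (U A : set C) (g h : C -> C).

Definition holomorphic_on U g : Prop := forall z, U z -> derivable g z 1.

(* Every R-linear map C -> C has the form [fun t => a * t + b * t^*] for unique
   a and b (the Wirtinger derivatives); so this is Frechet differentiability
   of g at z as a map of the real plane. *)
Definition real_differential g (z a b : C) : Prop :=
  (g (z + t) - g z - (a * t + b * t^*)) / t @[t --> 0^'] --> (0 : C).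

(* Class C^n in the real-variable sense, for U open. *)
Fixpoint Cn (n : nat) U g : Prop :=
  match n with
  | 0 => forall z, U z -> {for z, continuous g}
  | m.+1 => exists a b : C -> C,
      [/\ forall z, U z -> real_differential g z (a z) (b z),
          Cn m U a & Cn m U b]
  end.

Definition Cinfty U g : Prop := forall n, Cn n U g.

(* A regularity property defined on open sets is said to hold in an arbitrary
   set A if it holds for an extension of g to a neighborhood of A. *)
Definition in_nbhd (P : set C -> (C -> C) -> Prop) A g : Prop :=
  exists U h, [/\ open U, A `<=` U, forall z, A z -> h z = g z & P U h].

End Regularity.

(* Main.v *)
Require Import Defs.
From HB Require Import structures.
From mathcomp Require Import all_boot all_order all_algebra.
From mathcomp Require Import separable.
From mathcomp Require Import complex.
From mathcomp Require Import all_classical all_reals all_analysis.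
From mathcomp Require Import ring.
Import Order.TTheory GRing.Theory Num.Theory.
Import numFieldNormedType.Exports.
Local Open Scope classical_set_scope.
Local Open Scope ring_scope.

Set Implicit Arguments.
Unset Strict Implicit.
Unset Printing Implicit Defensive.

(** The idea is a push-forward along the fibres of r. Clearing the denominator q,
    the right-hand side of the representation at a point z of the fibre over w is
    F(z) / q(z), where F is a polynomial of degree less than d with
    F(lambda_k) = q(lambda_k) f_k(w). If w is not a critical value, the fibre over w
    consists of d distinct points, so F, and with it f(w), is determined by the d
    numbers phi(z), z in the fibre, by interpolation. This is existence and
    uniqueness; the regularity comes from making the interpolation explicit.

    Put s_k = p / (X - lambda_k) and W = p' q - p q', so that r' = W / q ^ 2. The
    Bezoutian of p and q at y,

       B_y(z) = (q(y) p(z) - p(y) q(z)) / (z - y),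

    has degree less than d, takes the value q(lambda_k) s_k(y) at lambda_k and
    W(y) at y, and vanishes at the points of the fibre of r through y other than y.
    Expanding it by Lagrange interpolation at the roots of p gives
    [delta_dual]: for y and z in one regular fibre,

       sum_k delta_k(z) kappa_k(y) = 1 if z = y, and 0 otherwise,

    where kappa_k = s_k q / W is called [dual_delta] below. So the d x d matrices of the delta_k and of the kappa_k on a regular fibre are
    inverse to each other, and the unique f is

       f_k(w) = sum of phi(z) kappa_k(z) over the points z with r(z) = w.

    The functions kappa_k are rational without poles at regular points, hence the
    regularity statement is about the operator [trace], which sums a function over
    the fibres of r. Near a noncritical w0 the points of the fibre are d functions
    of w, continuous at w0 ([fiber_branches]): the product of the distances from z_j to the
    roots of p - w q is |w - w0| |q(z_j) / lead(p)|, so one of these roots is close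
    to z_j. Each branch is a section of r and is therefore complex differentiable at
    w0 with derivative 1 / r'. Hence the Wirtinger derivatives of the trace of h are
    trace (h_z / r') and trace (h_zbar / conj r'), which are traces again. Induction
    on n gives class C^n without any inverse function theorem, and h_zbar = 0 gives
    the holomorphic case. *)

(** * Wirtinger derivatives *)

Section RealDifferential.
Variable C : numClosedFieldType.
Implicit Types (f g h : C -> C) (z w a b : C).

Lemma cvg_dist T (F : set_system T) {FF : Filter F} (f : T -> C) (l : C) :
  (forall e : C, 0 < e -> \forall t \near F, `|l - f t| < e) -> f @ F --> l.
Proof. by move=> fl; apply/cvgrPdist_lt. Qed.

Lemma cvg_near_eq T (F : set_system T) {FF : Filter F} (f g : T -> C) (l : C) :
  (\forall t \near F, f t = g t) -> f @ F --> l -> g @ F --> l.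
Proof. by move=> fg; apply: cvg_trans; exact: near_eq_cvg. Qed.

Lemma cvg_conj T (F : set_system T) {FF : Filter F} (f : T -> C) (l : C) :
  f @ F --> l -> (f t)^* @[t --> F] --> l^*.
Proof.
move=> fl; apply: cvg_dist => e e0; near=> t.
rewrite -rmorphB norm_conjC; near: t; exact: (@cvgr_dist_lt _ _ _ _ _ f l fl).
Unshelve. all: by end_near. Qed.

Lemma near0_shift z (P : set C) :
  (\forall y \near z, P y) -> \forall t \near 0, P (z + t).
Proof.
rewrite (near_shift 0 z) subr0; apply: filterS => t /=.
by rewrite addrC.
Qed.

(** The whole error can be absorbed into the coefficient of [y - z]. It is done on one
    side only, so that the conjugate term disappears when [b = 0]. *)
Lemma real_differential_slope g z a b : real_differential g z a b ->
  exists2 A : C -> C, A y @[y --> z] --> a &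
    \forall y \near z, g y = g z + A y * (y - z) + b * (y - z)^*.
Proof.
move=> dg; pose E y := (g y - g z - (a * (y - z) + b * (y - z)^*)) / (y - z).
exists (fun y => a + E y).
  have Ez : a + E z = a by rewrite /E (subrr z) invr0 mulr0 addr0.
  rewrite -[X in _ --> X]Ez; apply/(continuous_withinNshiftx (fun y => a + E y)).
  rewrite Ez -[X in _ --> X]addr0.
  apply: cvgD; first exact: (@cvg_cst C _ C 0^' _).
  apply: cvg_near_eq dg; near=> t.
  by rewrite /E /shift /= addrK (addrC t z).
near=> y; have [->|yz] := eqVneq y z; first by rewrite subrr rmorph0 !mulr0 !addr0.
by rewrite mulrDl /E divfK ?subr_eq0//; ring.
Unshelve. all: by end_near. Qed.

(** Caratheodory's form of differentiability: in place of a remainder there are two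
    slopes with limits [a] and [b]. This makes sums, products and
    compositions a matter of algebra and of limits of the slopes. *)
Lemma real_differentialP g z a b :
  real_differential g z a b <->
  exists A B : C -> C, [/\ A y @[y --> z] --> a, B y @[y --> z] --> b &
    \forall y \near z, g y = g z + A y * (y - z) + B y * (y - z)^*].
Proof.
split=> [/real_differential_slope[A Aa gE]|[A [B [Aa Bb gE]]]].
  by exists A, (fun=> b); split=> //; exact: (@cvg_cst C _ C (nbhs _) _).
apply: cvg_dist => e e0; have e2 : 0 < e / 2 by rewrite divr_gt0.
near=> t.
have t0 : t != 0 by near: t; exact: nbhs_dnbhs_neq.
rewrite sub0r normrN.
have -> : g (z + t) = g z + A (z + t) * t + B (z + t) * t^*.
  have {3 5}-> : t = z + t - z by ring.
  near: t; apply: nbhs_dnbhs.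
  exact: (@near0_shift z
    (fun y => g y = g z + A y * (y - z) + B y * (y - z)^*)).
have -> : (g z + A (z + t) * t + B (z + t) * t^* - g z - (a * t + b * t^*)) / t
  = (A (z + t) - a) + (B (z + t) - b) * (t^* / t) by field; exact: t0.
apply: le_lt_trans (ler_normD _ _) _.
rewrite normrM normf_div norm_conjC divff ?normr_eq0// mulr1.
rewrite [e]splitr; apply: ltrD; rewrite distrC; near: t; apply: nbhs_dnbhs.
  apply: (@near0_shift z (fun y => `|a - A y| < e / 2)).
  exact: (@cvgr_dist_lt _ _ _ _ _ A a Aa).
apply: (@near0_shift z (fun y => `|b - B y| < e / 2)).
exact: (@cvgr_dist_lt _ _ _ _ _ B b Bb).
Unshelve. all: by end_near. Qed.

Lemma real_differential_near g h z a b :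
  (\forall y \near z, g y = h y) ->
  real_differential h z a b -> real_differential g z a b.
Proof.
move=> gh /real_differentialP[A [B [Aa Bb hE]]]; apply/real_differentialP.
exists A, B; split=> //; near=> y.
have -> : g y = h y by near: y; exact: gh.
rewrite (nbhs_singleton gh).
by near: y; exact: hE.
Unshelve. all: by end_near. Qed.

Lemma real_differential_continuous g z a b :
  real_differential g z a b -> {for z, continuous g}.
Proof.
move=> /real_differentialP[A [B [Aa Bb gE]]].
have yz : (y - z) @[y --> z] --> z - z.
  exact: (cvgB (@cvg_id _ (nbhs z)) (cvg_cst z)).
have : g z + A y * (y - z) + B y * (y - z)^* @[y --> z] -->
    g z + a * (z - z) + b * (z - z)^*.
  exact: (cvgD (cvgD (cvg_cst (g z)) (cvgM Aa yz)) (cvgM Bb (cvg_conj yz))).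
rewrite subrr rmorph0 !mulr0 !addr0; apply: (@cvg_near_eq _ (nbhs z)).
by near=> y; apply/esym; near: y; exact: gE.
Unshelve. all: by end_near. Qed.

Lemma real_differential_cst (x : C) z : real_differential (fun=> x) z 0 0.
Proof.
apply/real_differentialP; exists (fun=> 0), (fun=> 0).
split; try exact: (@cvg_cst C _ C (nbhs z)).
by near=> y; rewrite !mul0r !addr0.
Unshelve. all: by end_near. Qed.

Lemma real_differential_id z : real_differential id z 1 0.
Proof.
apply/real_differentialP; exists (fun=> 1), (fun=> 0).
split; try exact: (@cvg_cst C _ C (nbhs z)).
by near=> y; rewrite mul0r mul1r addr0 addrC subrK.
Unshelve. all: by end_near. Qed.

Lemma real_differentialD f g z a b a' b' :
  real_differential f z a b -> real_differential g z a' b' ->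
  real_differential (fun y => f y + g y) z (a + a') (b + b').
Proof.
move=> /real_differentialP[A [B [Aa Bb fE]]].
move=> /real_differentialP[A' [B' [Aa' Bb' gE]]].
apply/real_differentialP; exists (fun y => A y + A' y), (fun y => B y + B' y).
split; [exact: cvgD Aa Aa'|exact: cvgD Bb Bb'|near=> y].
have -> : f y = f z + A y * (y - z) + B y * (y - z)^* by near: y; exact: fE.
have -> : g y = g z + A' y * (y - z) + B' y * (y - z)^* by near: y; exact: gE.
ring.
Unshelve. all: by end_near. Qed.

Lemma real_differentialM f g z a b a' b' :
  real_differential f z a b -> real_differential g z a' b' ->
  real_differential (fun y => f y * g y) z
    (a * g z + f z * a') (b * g z + f z * b').
Proof.
move=> df dg; have cg := real_differential_continuous dg.
move: df => /real_differentialP[A [B [Aa Bb fE]]].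
move: dg => /real_differentialP[A' [B' [Aa' Bb' gE]]].
apply/real_differentialP.
exists (fun y => A y * g y + f z * A' y), (fun y => B y * g y + f z * B' y).
have cf : f z @[_ --> z] --> f z by exact: (@cvg_cst C _ C (nbhs z)).
split; [exact: cvgD (cvgM Aa cg) (cvgM cf Aa')
       |exact: cvgD (cvgM Bb cg) (cvgM cf Bb')|near=> y].
have fy : f y = f z + A y * (y - z) + B y * (y - z)^* by near: y; exact: fE.
have gy : g y = g z + A' y * (y - z) + B' y * (y - z)^* by near: y; exact: gE.
rewrite -[f y](subrK (f z)) mulrDl {2}gy {1}fy; ring.
Unshelve. all: by end_near. Qed.

Lemma real_differential_conj f z a b :
  real_differential f z a b ->
  real_differential (fun y => (f y)^*) z b^* a^*.
Proof.
move=> /real_differentialP[A [B [Aa Bb fE]]].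
apply/real_differentialP; exists (fun y => (B y)^*), (fun y => (A y)^*).
split; [exact: cvg_conj Bb|exact: cvg_conj Aa|near=> y].
have -> : f y = f z + A y * (y - z) + B y * (y - z)^* by near: y; exact: fE.
by move: (y - z) => t; rewrite !rmorphD !rmorphM /= conjCK addrAC.
Unshelve. all: by end_near. Qed.

Lemma real_differential_inv f z a b : f z != 0 ->
  real_differential f z a b ->
  real_differential (fun y => (f y)^-1) z (- (a / f z ^+ 2)) (- (b / f z ^+ 2)).
Proof.
move=> fz df; have cf := real_differential_continuous df.
move: df => /real_differentialP[A [B [Aa Bb fE]]].
have ff : f y * f z @[y --> z] --> f z * f z.
  exact: cvgM cf (cvg_cst (f z)).
have fz2 : f z * f z != 0 by rewrite mulf_neq0.
apply/real_differentialP.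
exists (fun y => - (A y / (f y * f z))), (fun y => - (B y / (f y * f z))).
split.
- by rewrite expr2; exact: cvgN (cvgM Aa (cvgV fz2 ff)).
- by rewrite expr2; exact: cvgN (cvgM Bb (cvgV fz2 ff)).
near=> y.
have fy0 : f y != 0 by near: y; exact: (cvgr_neq0 _ cf).
have fy : f y - f z = A y * (y - z) + B y * (y - z)^*.
  apply/eqP; rewrite subr_eq [_ + f z]addrC addrA; apply/eqP.
  by near: y; exact: fE.
have -> : (f y)^-1 = (f z)^-1 - (f y - f z) / (f y * f z).
  by field; rewrite fz fy0.
rewrite fy; ring.
Unshelve. all: by end_near. Qed.

(** Chain rule for the Wirtinger derivatives. *)
Lemma real_differential_comp f g z a b a' b' :
  real_differential f (g z) a b -> real_differential g z a' b' ->
  real_differential (f \o g) z (a * a' + b * b'^*) (a * b' + b * a'^*).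
Proof.
move=> df dg; have cg := real_differential_continuous dg.
move: df => /real_differentialP[A [B [Aa Bb fE]]].
move: dg => /real_differentialP[A' [B' [Aa' Bb' gE]]].
apply/real_differentialP.
exists (fun y => A (g y) * A' y + B (g y) * (B' y)^*),
       (fun y => A (g y) * B' y + B (g y) * (A' y)^*).
have cA : A (g y) @[y --> z] --> a by exact: cvg_comp cg Aa.
have cB : B (g y) @[y --> z] --> b by exact: cvg_comp cg Bb.
split.
- exact: cvgD (cvgM cA Aa') (cvgM cB (cvg_conj Bb')).
- exact: cvgD (cvgM cA Bb') (cvgM cB (cvg_conj Aa')).
near=> y.
have gy : g y - g z = A' y * (y - z) + B' y * (y - z)^*.
  apply/eqP; rewrite subr_eq [_ + g z]addrC addrA; apply/eqP.
  by near: y; exact: gE.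
have -> : (f \o g) y = f (g z) + A (g y) * (g y - g z) + B (g y) * (g y - g z)^*.
  by near: y; exact: (cg _ fE).
by rewrite gy; move: (y - z) => t; rewrite rmorphD !rmorphM /= conjCK; ring.
Unshelve. all: by end_near. Qed.

Lemma real_differential_sum (I : Type) (r : seq I) (F : I -> C -> C)
    (a b : I -> C) z :
  (forall i, real_differential (F i) z (a i) (b i)) ->
  real_differential (fun y => \sum_(i <- r) F i y) z
    (\sum_(i <- r) a i) (\sum_(i <- r) b i).
Proof.
move=> dF; elim: r => [|i r IH].
  rewrite !big_nil; apply: real_differential_near (real_differential_cst 0 z).
  by near=> y; rewrite big_nil.
rewrite !big_cons; apply: real_differential_near (real_differentialD (dF i) IH).
by near=> y; rewrite big_cons.
Unshelve. all: by end_near. Qed.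

Lemma derivable_real_differential f z :
  derivable f z 1 -> real_differential f z (derive1 f z) 0.
Proof.
move=> df.
have : h^-1 *: (f (h + z) - f z) @[h --> 0^'] --> derive1 f z.
  by rewrite derive1E; move: df; rewrite /derivable /derive /=;
     under eq_fun do rewrite /GRing.scale/= mulr1.
move=> dfz; rewrite /real_differential.
rewrite -[X in _ --> X](subrr (derive1 f z)).
apply: cvg_near_eq (cvgB dfz (cvg_cst (derive1 f z))); near=> h => /=.
have h0 : h != 0 by near: h; exact: nbhs_dnbhs_neq.
by rewrite !fctE /GRing.scale/= [h + z]addrC mul0r addr0; field; exact: h0.
Unshelve. all: by end_near. Qed.

Lemma real_differential_derivable f z a :
  real_differential f z a 0 -> derivable f z 1 /\ derive1 f z = a.
Proof.
move=> df.
have H : h^-1 *: (f (h + z) - f z) @[h --> 0^'] --> a.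
  rewrite -[a in _ --> a]add0r.
  apply: cvg_near_eq (cvgD df (cvg_cst a)); near=> h => /=.
  have h0 : h != 0 by near: h; exact: nbhs_dnbhs_neq.
  by rewrite !fctE /GRing.scale/= [h + z]addrC mul0r addr0; field; exact: h0.
split; last by rewrite /derive1; exact: cvg_lim.
rewrite /derivable; apply/cvg_ex; exists a.
by under eq_fun do rewrite /GRing.scale/= mulr1.
Unshelve. all: by end_near. Qed.

Lemma real_differential_horner (p : {poly C}) z :
  real_differential (horner p) z p^`().[z] 0.
Proof.
elim/poly_ind: p => [|p c IH].
  rewrite deriv0 horner0; apply: real_differential_near (real_differential_cst 0 z).
  by near=> y; rewrite horner0.
have := real_differentialD (real_differentialM IH (real_differential_id z))
          (real_differential_cst c z).
rewrite mul0r mulr0 !addr0 mulr1 derivD derivC addr0 derivM derivX mulr1.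
rewrite hornerD hornerMX; apply: real_differential_near.
by near=> y; rewrite hornerD hornerMX hornerC.
Unshelve. all: by end_near. Qed.

Lemma real_differential_ratfun (p q : {poly C}) z : q.[z] != 0 ->
  real_differential (ratfun p q) z
    (ratfun (p^`() * q - p * q^`()) (q ^+ 2) z) 0.
Proof.
move=> qz; have := real_differentialM (real_differential_horner p z)
  (real_differential_inv qz (real_differential_horner q z)).
rewrite !mul0r oppr0 mulr0 addr0.
have <- // : p^`().[z] / q.[z] + p.[z] * - (q^`().[z] / q.[z] ^+ 2) =
  ratfun (p^`() * q - p * q^`()) (q ^+ 2) z.
by rewrite /ratfun hornerD hornerN !hornerM; field; exact: qz.
Unshelve. all: by end_near. Qed.

Lemma ratfun_continuous (p q : {poly C}) z : q.[z] != 0 ->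
  {for z, continuous (ratfun p q)}.
Proof. by move=> /(real_differential_ratfun p)/real_differential_continuous. Qed.

Lemma derive1_ratfun (p q : {poly C}) z : q.[z] != 0 ->
  derive1 (ratfun p q) z = (p^`().[z] * q.[z] - p.[z] * q^`().[z]) / q.[z] ^+ 2.
Proof.
move=> /(real_differential_ratfun p)/real_differential_derivable[_ ->].
by rewrite /ratfun hornerD hornerN !hornerM.
Qed.

End RealDifferential.

(** Differentiability of an inverse function, with continuity of the inverse given
    beforehand: the slope of the section [g] is the reciprocal of that of [f]. *)
Lemma real_differential_section (C : numClosedFieldType) (f g : C -> C) (w a : C) :
  a != 0 -> real_differential f (g w) a 0 -> {for w, continuous g} ->
  (\forall y \near w, f (g y) = y) -> real_differential g w a^-1 0.
Proof.
move=> a0 /real_differential_slope[A Aa fE] cg fg.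
have cA : A (g y) @[y --> w] --> a by exact: cvg_comp cg Aa.
apply/real_differentialP; exists (fun y => (A (g y))^-1), (fun=> 0); split.
- exact: cvgV a0 cA.
- exact: (@cvg_cst C _ C (nbhs w)).
near=> y.
have A0 : A (g y) != 0 by near: y; exact: (cvgr_neq0 _ cA).
have fgy : f (g y) = y by near: y; exact: fg.
have : f (g y) = f (g w) + A (g y) * (g y - g w) + 0 * (g y - g w)^*.
  by near: y; exact: (cg _ fE).
rewrite fgy (nbhs_singleton fg) !mul0r !addr0 => yE.
by rewrite {3}yE [w + _]addrC addrK mulrA mulVf// mul1r addrC subrK.
Unshelve. all: by end_near. Qed.

(** * Holomorphic functions and functions of class C^n *)

Section ClassCn.
Variable C : numClosedFieldType.
Implicit Types (U V : set C) (f g : C -> C) (z : C).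

Lemma sub_Cn n U V f : U `<=` V -> Cn n V f -> Cn n U f.
Proof.
elim: n f => [|n IH] f UV /=; first by move=> cf z /UV; exact: cf.
move=> [a [b [df ca cb]]]; exists a, b; split; [|exact: IH|exact: IH].
by move=> z /UV; exact: df.
Qed.

Lemma Cn_continuous n U f z : Cn n U f -> U z -> {for z, continuous f}.
Proof.
case: n => [|n] /=; first exact.
by move=> [a [b [df _ _]]] Uz; exact: real_differential_continuous (df z Uz).
Qed.

Lemma CnW n U f : Cn n.+1 U f -> Cn n U f.
Proof.
elim: n f => [|n IH] f; first by move=> cf z Uz; exact: Cn_continuous cf Uz.
by move=> [a [b [df ca cb]]]; exists a, b; split => //; exact: IH.
Qed.

Lemma CnD n U f g : Cn n U f -> Cn n U g -> Cn n U (fun z => f z + g z).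
Proof.
elim: n f g => [|n IH] f g /=.
  by move=> cf cg z Uz; exact: cvgD (cf z Uz) (cg z Uz).
move=> [a [b [df ca cb]]] [a' [b' [dg ca' cb']]].
exists (fun z => a z + a' z), (fun z => b z + b' z); split; [|exact: IH|exact: IH].
by move=> z Uz; exact: real_differentialD (df z Uz) (dg z Uz).
Qed.

Lemma CnM n U f g : Cn n U f -> Cn n U g -> Cn n U (fun z => f z * g z).
Proof.
elim: n f g => [|n IH] f g.
  by move=> cf cg z Uz; exact: cvgM (cf z Uz) (cg z Uz).
move=> cf cg; have cf' := CnW cf; have cg' := CnW cg.
move: cf cg => [a [b [df ca cb]]] [a' [b' [dg ca' cb']]].
exists (fun z => a z * g z + f z * a' z), (fun z => b z * g z + f z * b' z).
split; [|by apply: CnD; exact: IH|by apply: CnD; exact: IH].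
by move=> z Uz; exact: real_differentialM (df z Uz) (dg z Uz).
Qed.

Lemma Cn_conj n U f : Cn n U f -> Cn n U (fun z => (f z)^*).
Proof.
elim: n f => [|n IH] f /=; first by move=> cf z Uz; exact: cvg_conj (cf z Uz).
move=> [a [b [df ca cb]]]; exists (fun z => (b z)^*), (fun z => (a z)^*).
split; [|exact: IH|exact: IH].
by move=> z Uz; exact: real_differential_conj (df z Uz).
Qed.

(** The zero derivative with respect to the conjugate variable is written as the
    rational function [0 / q], so that the induction hypothesis covers it. *)
Lemma Cn_ratfun n U (p q : {poly C}) :
  (forall z, U z -> q.[z] != 0) -> Cn n U (ratfun p q).
Proof.
elim: n p q => [|n IH] p q q0 /=; first by move=> z /q0; exact: ratfun_continuous.
exists (ratfun (p^`() * q - p * q^`()) (q ^+ 2)), (ratfun 0 q); split.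
- move=> z /q0 qz; have -> : ratfun 0 q z = 0 by rewrite /ratfun horner0 mul0r.
  exact: real_differential_ratfun.
- by apply: IH => z /q0 qz; rewrite horner_exp expf_neq0.
- exact: IH.
Qed.

Lemma holomorphic_onP U f : holomorphic_on U f <->
  exists a : C -> C, forall z, U z -> real_differential f z (a z) 0.
Proof.
split=> [df|[a df] z Uz]; last by case: (real_differential_derivable (df z Uz)).
by exists (derive1 f) => z /df; exact: derivable_real_differential.
Qed.

Lemma holomorphic_onM U f g : holomorphic_on U f -> holomorphic_on U g ->
  holomorphic_on U (fun z => f z * g z).
Proof.
move=> /holomorphic_onP[a df] /holomorphic_onP[b dg]; apply/holomorphic_onP.
exists (fun z => a z * g z + f z * b z) => z Uz.
by have := real_differentialM (df z Uz) (dg z Uz); rewrite mul0r mulr0 addr0.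
Qed.

Lemma holomorphic_on_ratfun U (p q : {poly C}) :
  (forall z, U z -> q.[z] != 0) -> holomorphic_on U (ratfun p q).
Proof.
move=> q0; apply/holomorphic_onP.
exists (ratfun (p^`() * q - p * q^`()) (q ^+ 2)) => z /q0.
exact: real_differential_ratfun.
Qed.

End ClassCn.

(** * Fibres of a rational function *)

Section Fibers.
Variables (C : numClosedFieldType) (d : nat) (p q : {poly C}).
Hypotheses (size_p : size p = d.+1) (size_q : (size q < size p)%N).
Hypothesis (coprime_pq : coprimep p q).
Implicit Types (U A : set C) (h : C -> C) (z w : C).

(** The roots of [p - w q], with multiplicity. *)
Definition fiber w : seq C := sval (closed_field_poly_normal (p - w *: q)).

(** The numerator of the derivative of [p / q]. *)
Definition wronskian : {poly C} := p^`() * q - p * q^`().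

Definition regular : set C := [set z | q.[z] != 0 /\ wronskian.[z] != 0].

Let size_wq w : (size (- (w *: q))%R < size p)%N.
Proof. by rewrite size_polyN (leq_ltn_trans (size_scale_leq _ _)). Qed.

Lemma fiberE w :
  p - w *: q = lead_coef p *: \prod_(z <- fiber w) ('X - z%:P).
Proof.
rewrite -(lead_coefDl (size_wq w)) /fiber.
by case: closed_field_poly_normal.
Qed.

Let lead_p : lead_coef p != 0.
Proof. by rewrite lead_coef_eq0 -size_poly_eq0 size_p. Qed.

Lemma size_fiber w : size (fiber w) = d.
Proof.
apply: succn_inj; rewrite -size_p -(size_polyDl (size_wq w)) fiberE.
by rewrite size_scale// size_prod_XsubC.
Qed.

Lemma horner_fiber w z :
  p.[z] - w * q.[z] = lead_coef p * \prod_(y <- fiber w) (z - y).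
Proof.
have := congr1 (horner^~ z) (fiberE w).
rewrite hornerD hornerN !hornerZ horner_prod => ->; congr (_ * _).
by apply: eq_bigr => y _; rewrite hornerXsubC.
Qed.

Lemma mem_fiber w z : (z \in fiber w) = (p.[z] == w * q.[z]).
Proof.
rewrite -root_prod_XsubC -subr_eq0 -(rootZ _ _ lead_p) -fiberE /root.
by rewrite hornerD hornerN hornerZ.
Qed.

(** Since [p] and [q] are coprime, no root of [p - w q] is a pole. *)
Lemma mem_fiberP w z : (z \in fiber w) <-> q.[z] != 0 /\ ratfun p q z = w.
Proof.
rewrite mem_fiber; split=> [/eqP pz|[qz <-]]; last by rewrite divfK.
have qz : q.[z] != 0.
  apply: contraPneq (oner_neq0 C) => qz; move: pz; rewrite qz mulr0 => /eqP pz.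
  by move: (coprimep_root coprime_pq pz); rewrite qz eqxx.
by rewrite /ratfun pz mulfK.
Qed.

(** At a point of the fibre over [w], [q] times the derivative of [p - w q] is the
    Wronskian; so a fibre of regular points has no multiple root. *)
Lemma uniq_fiber w : (forall z, z \in fiber w -> regular z) -> uniq (fiber w).
Proof.
move=> reg; rewrite -separable_prod_XsubC unlock.
apply/Pdiv.ClosedField.coprimepP => x; rewrite root_prod_XsubC => xw.
have [qx Wx] := reg _ xw; move: xw; rewrite mem_fiber => /eqP px.
apply: contra_neq Wx => P'x.
have := congr1 (fun P : {poly C} => P^`().[x]) (fiberE w).
rewrite derivB !derivZ hornerD hornerN !hornerZ P'x mulr0 => /eqP.
rewrite subr_eq0 => /eqP p'x.
by rewrite /wronskian hornerD hornerN !hornerM p'x px; ring.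
Qed.

Lemma horner_continuous (f : {poly C}) z : {for z, continuous (horner f)}.
Proof. exact: real_differential_continuous (real_differential_horner f z). Qed.

Lemma open_regular : open regular.
Proof.
rewrite openE => z [qz Wz]; rewrite /interior; near=> y; split.
  by near: y; exact: (cvgr_neq0 _ (@horner_continuous q z)).
by near: y; exact: (cvgr_neq0 _ (@horner_continuous wronskian z)).
Unshelve. all: by end_near. Qed.

(** The right-hand side is the product of the distances from [z] to the [d] points of the
    fibre, and the smallest of [d] factors satisfies this bound. *)
Lemma fiber_near w z : (0 < d)%N ->
  exists2 y, y \in fiber w &
    `|z - y| ^+ d <= `|p.[z] - w * q.[z]| / `|lead_coef p|.
Proof.
move=> d0; set t := _ / _.
have tE : t = \prod_(y <- fiber w) `|z - y|.
  by rewrite /t horner_fiber normrM normr_prod mulrC mulKf// normr_eq0.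
have t0 : 0 <= t by rewrite divr_ge0.
have [/hasP[y yw zy]|/hasPn far] :=
  boolP (has (fun y => `|z - y| ^+ d <= t) (fiber w)); first by exists y.
suff : t ^+ d < t ^+ d by rewrite ltxx.
have {1}-> : t ^+ d = \prod_(y <- fiber w | y \in fiber w) t.
  by rewrite -big_seq big_const_seq count_predT size_fiber iter_mulr_1.
have -> : t ^+ d = \prod_(y <- fiber w | y \in fiber w) `|z - y| ^+ d.
  by rewrite -big_seq prodrXl -tE.
apply: ltr_prod => [|y yw].
  by apply/hasP; exists (nth 0 (fiber w) 0); rewrite mem_nth// size_fiber.
by rewrite t0 real_ltNge ?far// ger0_real// exprn_ge0.
Qed.

(** Over a neighborhood of [w0] the fibre consists of [d] branches, continuous at [w0].
    For each point of the fibre over [w0], choose by [fiber_near] a nearby point of the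
    fibre over [w]. As the points over [w0] are distinct, so are the chosen ones for
    [w] close to [w0], and being [d] in number they exhaust the fibre. *)
Lemma fiber_branches w0 : (forall z, z \in fiber w0 -> regular z) ->
  exists zeta : 'I_d -> C -> C,
    (forall j, {for w0, continuous (zeta j)}) /\
    \forall w \near w0, perm_eq (fiber w) [seq zeta j w | j : 'I_d].
Proof.
move=> reg; have Uw0 := uniq_fiber reg.
pose z (j : 'I_d) := nth 0 (fiber w0) j.
have zw0 j : p.[z j] = w0 * q.[z j].
  by apply/eqP; rewrite -mem_fiber mem_nth// size_fiber.
have /choice[zeta zetaP] : forall jw : 'I_d * C, exists y, y \in fiber jw.2 /\
    `|z jw.1 - y| ^+ d <= `|(w0 - jw.2) * q.[z jw.1]| / `|lead_coef p|.
  move=> [j w] /=; have [|y yw zy] := @fiber_near w (z j).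
    exact: leq_ltn_trans (leq0n j) (ltn_ord j).
  by exists y; split=> //; rewrite mulrBl -zw0.
have zeta_mem j w : zeta (j, w) \in fiber w by have [] := zetaP (j, w).
have zetaE j : zeta (j, w0) = z j.
  have [_ /=] := zetaP (j, w0); rewrite subrr mul0r normr0 mul0r => le0.
  have : `|z j - zeta (j, w0)| ^+ d == 0 by rewrite eq_le le0 exprn_ge0.
  by rewrite expf_eq0 normr_eq0 subr_eq0 => /andP[_ /eqP].
have zeta_cvg j : zeta (j, w) @[w --> w0] --> z j.
  have d0 : (0 < d)%N by exact: leq_ltn_trans (leq0n j) (ltn_ord j).
  apply: (@cvg_dist _ _ (nbhs w0)) => e e0.
  have cw : `|(w0 - w) * q.[z j]| / `|lead_coef p| @[w --> w0] --> (0 : C).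
    have : `|(w0 - w) * q.[z j]| / `|lead_coef p| @[w --> w0] -->
        `|(w0 - w0) * q.[z j]| / `|lead_coef p|.
      exact: cvgM (cvg_norm (cvgM (cvgB (cvg_cst w0) (@cvg_id _ (nbhs w0)))
        (cvg_cst q.[z j]))) (cvg_cst `|lead_coef p|^-1).
    by rewrite subrr mul0r normr0 mul0r.
  have ed : 0 < e ^+ d by rewrite exprn_gt0.
  near=> w.
  rewrite -(@ltr_pXn2r _ d)// ?nnegrE ?(ltW e0)//.
  have [_ /= le] := zetaP (j, w); apply: le_lt_trans le _.
  suff : `|0 - `|(w0 - w) * q.[z j]| / `|lead_coef p| | < e ^+ d.
    by rewrite sub0r normrN normrM normfV !normr_id.
  by near: w; exact: (@cvgr_dist_lt _ _ _ _ _ _ _ cw).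
exists (fun j w => zeta (j, w)); split; first by move=> j; have := zeta_cvg j; rewrite -zetaE.
have inj : \forall w \near w0, forall ij : 'I_d * 'I_d,
    ij.1 != ij.2 -> zeta (ij.1, w) - zeta (ij.2, w) != 0.
  apply: (@filter_forall _ _ _ (nbhs w0)) => -[i j] /=; have [->|ij] := eqVneq i j.
    by near=> w.
  have zij : z i - z j != 0 by rewrite subr_eq0 nth_uniq ?size_fiber.
  near=> w => _; near: w.
  exact: (cvgr_neq0 _ (cvgB (zeta_cvg i) (zeta_cvg j))).
near=> w.
have injw : injective (fun j => zeta (j, w)).
  move=> i j /eqP; apply: contraTeq => ij; rewrite -subr_eq0.
  by apply: (near inj w _ (i, j)).
have Uc : uniq [seq zeta (j, w) | j : 'I_d].
  by rewrite map_inj_uniq ?enum_uniq.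
have sub : {subset [seq zeta (j, w) | j : 'I_d] <= fiber w}.
  by move=> _ /fintype.imageP[j _ ->].
have le : (size (fiber w) <= size [seq zeta (j, w) | j : 'I_d])%N.
  by rewrite size_fiber size_image card_ord.
have [_ eqm] := uniq_min_size Uc sub le.
rewrite perm_sym; apply: uniq_perm => //.
exact: leq_size_uniq Uc sub le.
Unshelve. all: by end_near. Qed.

(** * Summation over the fibres *)

Definition trace h w : C := \sum_(z <- fiber w) h z.

(** [1 / r'], as the rational function [q ^ 2 / W]. *)
Definition reciprocal_derivative : C -> C := ratfun (q ^+ 2) wronskian.

Lemma real_differential_ratfun_fiber z : regular z ->
  real_differential (ratfun p q) z (reciprocal_derivative z)^-1 0.
Proof.
move=> [qz _]; rewrite /reciprocal_derivative /ratfun invf_div.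
exact: real_differential_ratfun.
Qed.

Lemma trace_branches w0 : (forall z, z \in fiber w0 -> regular z) ->
  exists zeta : 'I_d -> C -> C, [/\ forall j, {for w0, continuous (zeta j)},
    \forall w \near w0, forall z, z \in fiber w <-> exists j, z = zeta j w &
    \forall w \near w0, forall h, trace h w = \sum_(j < d) h (zeta j w)].
Proof.
move=> /fiber_branches[zeta [czeta zetaP]]; exists zeta; split=> //.
  apply: filterS zetaP => w /perm_mem zw z; rewrite zw.
  by split=> [/fintype.imageP[j _ ->]|[j ->]]; [exists j|exact: fintype.image_f].
by apply: filterS zetaP => w zw h; rewrite /trace (perm_big _ zw) big_image.
Qed.

(** The set [A] covers two situations: continuity relative to an arbitrary set, and,
    for [A = setT], continuity at a point. *)
Lemma trace_cvg A w0 h : (forall z, z \in fiber w0 -> regular z) ->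
  (forall z, z \in fiber w0 -> h @ within (ratpreim p q A) (nbhs z) --> h z) ->
  trace h @ within A (nbhs w0) --> trace h w0.
Proof.
move=> /trace_branches[zeta [czeta zetaP traceP]] ch.
rewrite (nbhs_singleton traceP).
apply: (@cvg_near_eq _ _ (within A (nbhs w0)) _
         (fun w => \sum_(j < d) h (zeta j w))).
  apply: (@cvg_within _ (nbhs w0) _ A).
  by apply: filterS traceP => w ->.
apply: cvg_big; first exact: add_continuous.
move=> j _; have zj0 : zeta j w0 \in fiber w0.
  by apply/(nbhs_singleton zetaP); exists j.
apply: cvg_comp (ch _ zj0) => P hP.
suff : \forall w \near w0, A w -> P (zeta j w) by [].
near=> w => Aw.
have /mem_fiberP[qz rz] : zeta j w \in fiber w.
  by apply/(near zetaP w) => //; exists j.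
have : ratpreim p q A (zeta j w) -> P (zeta j w).
  by near: w; exact: (czeta j _ hP).
by apply; split; rewrite ?rz.
Unshelve. all: by end_near. Qed.

(** Near [w0] the trace is the sum of [h] along the branches, which have
    derivative [1 / r']; apply the chain rule to each. The result is expressed by
    traces again, so that it can be differentiated repeatedly. *)
Lemma trace_real_differential h a b w0 :
  (forall z, z \in fiber w0 -> regular z) ->
  (forall z, z \in fiber w0 -> real_differential h z (a z) (b z)) ->
  real_differential (trace h) w0
    (trace (fun z => a z * reciprocal_derivative z) w0)
    (trace (fun z => b z * (reciprocal_derivative z)^*) w0).
Proof.
move=> reg dh; have [zeta [czeta zetaP traceP]] := trace_branches reg.
have mem0 j : zeta j w0 \in fiber w0.
  by apply/(nbhs_singleton zetaP); exists j.
rewrite !(nbhs_singleton traceP).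
apply: (@real_differential_near _ _ (fun w => \sum_(j < d) h (zeta j w))).
  by apply: filterS traceP => w ->.
apply: real_differential_sum => j.
have [qz Wz] := reg _ (mem0 j).
have dz : real_differential (zeta j) w0 (reciprocal_derivative (zeta j w0)) 0.
  rewrite -[reciprocal_derivative _]invrK.
  apply: (@real_differential_section _ (ratfun p q)) => //.
  - by rewrite invr_eq0 mulf_neq0 ?invr_eq0// horner_exp expf_neq0.
  - exact: real_differential_ratfun_fiber (reg _ (mem0 j)).
  apply: filterS zetaP => w zetaw.
  have : zeta j w \in fiber w by apply/zetaw; exists j.
  by case/mem_fiberP.
have := real_differential_comp (dh _ (mem0 j)) dz.
by rewrite rmorph0 !mulr0 addr0 add0r.
Qed.

Definition fiber_sub U : set C := [set w | forall z, z \in fiber w -> U z].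

Lemma open_fiber_sub U : open U -> U `<=` regular -> open (fiber_sub U).
Proof.
move=> oU Ureg; rewrite openE => w0 Uw0; rewrite /interior.
have [zeta [czeta zetaP _]] := trace_branches (fun z zw => Ureg z (Uw0 z zw)).
have Uzeta : \forall w \near w0, forall j, U (zeta j w).
  apply: (@filter_forall _ _ _ (nbhs w0)) => j.
  apply: (czeta j); apply: open_nbhs_nbhs; split=> //.
  by apply: Uw0; apply/(nbhs_singleton zetaP); exists j.
by apply: filterS2 zetaP Uzeta => w zetaw Uw z /zetaw[j ->].
Qed.

Lemma Cn_trace n U h : U `<=` regular -> Cn n U h ->
  Cn n (fiber_sub U) (trace h).
Proof.
move=> Ureg; elim: n h => [|n IH] h /=.
  move=> ch w Uw.
  have : trace h @ within setT (nbhs w) --> trace h w.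
    apply: trace_cvg => [z /Uw/Ureg//|z /Uw/ch hz].
    by move=> P /hz; exact: (@cvg_within _ (nbhs z)).
  by move=> ct P /ct; apply: (@filterS _ (nbhs w)) => x; apply.
move=> [a [b [dh ca cb]]].
have cr : Cn n U reciprocal_derivative by apply: Cn_ratfun => z /Ureg[].
exists (trace (fun z => a z * reciprocal_derivative z)),
       (trace (fun z => b z * (reciprocal_derivative z)^*)); split.
- move=> w Uw; apply: trace_real_differential => z /Uw Uz; last exact: dh.
  exact: Ureg.
- by apply: IH; exact: CnM.
- by apply: IH; apply: CnM => //; exact: Cn_conj.
Qed.

Lemma holomorphic_on_trace U h : U `<=` regular -> holomorphic_on U h ->
  holomorphic_on (fiber_sub U) (trace h).
Proof.
move=> Ureg /holomorphic_onP[a dh]; apply/holomorphic_onP.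
exists (trace (fun z => a z * reciprocal_derivative z)) => w Uw.
have -> : 0 = trace (fun z => 0 * (reciprocal_derivative z)^*) w.
  by rewrite /trace big1// => z _; rewrite mul0r.
apply: (trace_real_differential (b := fun=> 0)) => z /Uw Uz; last exact: dh.
exact: Ureg.
Qed.

(** For the three hypotheses on [P], think of a regularity class that is
    inherited by smaller sets and closed under products. An extension of [phi] to a
    neighborhood [U] of the preimage of [A] gives an extension of the trace to the set of
    points whose fibre consists of regular points of [U], which is a neighborhood of [A]. *)
Lemma in_nbhd_trace (P : set C -> (C -> C) -> Prop) A kappa phi :
  (forall U V g, U `<=` V -> P V g -> P U g) ->
  (forall U g h, P U g -> P U h -> P U (fun z => g z * h z)) ->
  (forall U h, U `<=` regular -> P U h -> P (fiber_sub U) (trace h)) ->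
  P regular kappa -> A `<=` fiber_sub regular ->
  in_nbhd P (ratpreim p q A) phi ->
  in_nbhd P A (trace (fun z => phi z * kappa z)).
Proof.
move=> subP mulP traceP Pkappa Areg [U [h [oU AU hE Ph]]].
have sub_reg : U `&` regular `<=` regular by move=> z [].
exists (fiber_sub (U `&` regular)), (trace (fun z => h z * kappa z)); split.
- by apply: open_fiber_sub => //; apply: openI => //; exact: open_regular.
- move=> w Aw z zw; split; last exact: Areg zw.
  by apply: AU; have [qz rz] := (mem_fiberP _ _).1 zw; split; rewrite ?rz.
- move=> w Aw; apply: eq_big_seq => z zw; rewrite hE//.
  by have [qz rz] := (mem_fiberP _ _).1 zw; split; rewrite ?rz.
- apply: traceP => //; apply: mulP; first by apply: subP Ph => z [].
  exact: subP Pkappa.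
Qed.

End Fibers.

Lemma noncritical_fiber (C : numClosedFieldType) (d : nat) (p q : {poly C}) :
  size p = d.+1 -> (size q < size p)%N -> coprimep p q ->
  ~` critical_values p q `<=` fiber_sub p q (regular p q).
Proof.
move=> size_p size_q copq w wc z /(mem_fiberP size_p size_q copq)[qz rz].
split=> //; apply: contra_not_neq wc => Wz; exists z; split=> //.
rewrite derive1_ratfun//; move: Wz.
by rewrite /wronskian hornerD hornerN !hornerM => ->; rewrite mul0r.
Qed.

(** * The dual system of the functions delta_k *)

Lemma deriv_simple_root (F : fieldType) (p : {poly F}) x :
  p != 0 -> mup x p = 1%N -> p^`().[x] != 0.
Proof.
move=> p0 mp; apply/eqP => p'x.
have xp : 'X - x%:P %| p by rewrite XsubC_dvd// mp.
have : (2 <= mup x p)%N; last by rewrite mp.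
rewrite mup_geq// expr2 -(divpK xp) dvdp_mul2r ?polyXsubC_eq0// dvdp_XsubCl /root.
move: p'x; rewrite -{1}(divpK xp) derivM derivXsubC mulr1 hornerD hornerM.
by rewrite hornerXsubC subrr mulr0 add0r => ->.
Qed.

Section Duality.
Variables (C : numClosedFieldType) (d : nat) (p q : {poly C}).
Variable lambda : 'I_d -> C.
Hypotheses (size_p : size p = d.+1) (size_q : (size q < size p)%N).
Hypothesis lambda_inj : injective lambda.
Hypothesis lambda_simple : forall k, mup (lambda k) p = 1%N.
Hypothesis q_lambda : forall k, q.[lambda k] != 0.
Implicit Types (w y z : C) (k : 'I_d).

Let p_neq0 : p != 0. Proof. by rewrite -size_poly_eq0 size_p. Qed.

Let root_lambda k : root p (lambda k).
Proof. by rewrite -dvdp_XsubCl XsubC_dvd// lambda_simple. Qed.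

Let p'_neq0 k : p^`().[lambda k] != 0.
Proof. exact: deriv_simple_root. Qed.

Let all_lambda (F : {poly C}) :
  (forall k, root F (lambda k)) -> all (root F) (codom lambda).
Proof. by move=> Fl; apply/allP => _ /codomP[k ->]; exact: Fl. Qed.

Let uniq_lambda : uniq (codom lambda).
Proof. by rewrite /codom map_inj_uniq ?enum_uniq. Qed.

Lemma coprime_ratfun : coprimep p q.
Proof.
apply/Pdiv.ClosedField.coprimepP => x; have := all_lambda root_lambda.
move=> /(all_roots_prod_XsubC _)-> //; last by rewrite uniq_rootsE.
  by rewrite rootZ ?lead_coef_eq0// root_prod_XsubC => /codomP[k ->].
by rewrite size_codom card_ord.
Qed.

Definition root_quotient k : {poly C} := p %/ ('X - (lambda k)%:P).

Lemma root_quotientK k : root_quotient k * ('X - (lambda k)%:P) = p.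
Proof. by rewrite divpK// dvdp_XsubCl. Qed.

Lemma size_root_quotient k : size (root_quotient k) = d.
Proof. by rewrite size_divp ?polyXsubC_eq0// size_XsubC size_p subn1. Qed.

Lemma root_quotient_lambda k j :
  (root_quotient k).[lambda j] = (j == k)%:R * p^`().[lambda k].
Proof.
have [->|jk] := eqVneq j k.
  rewrite mul1r -[in RHS](root_quotientK k) derivM derivXsubC mulr1 hornerD hornerM.
  by rewrite hornerXsubC subrr mulr0 add0r.
have /eqP : p.[lambda j] = 0 by apply/eqP; exact: root_lambda.
rewrite -(root_quotientK k) hornerM hornerXsubC mulf_eq0 subr_eq0 (inj_eq lambda_inj).
by rewrite (negPf jk) orbF mul0r => /eqP.
Qed.

Lemma lagrange_interpolation (F : {poly C}) : (size F <= d)%N ->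
  F = \sum_k (F.[lambda k] / p^`().[lambda k]) *: root_quotient k.
Proof.
move=> sF; apply/eqP; rewrite -subr_eq0; apply/eqP.
apply: roots_geq_poly_eq0 uniq_lambda _.
  apply: all_lambda => j; rewrite /root hornerD hornerN horner_sum (bigD1 j)//=.
  rewrite hornerZ root_quotient_lambda eqxx mul1r divfK// big1 ?addr0 ?subrr// => k kj.
  by rewrite hornerZ root_quotient_lambda eq_sym (negPf kj) mul0r mulr0.
rewrite size_codom card_ord (leq_trans (size_polyD _ _))// geq_max sF size_polyN.
apply: (leq_trans (size_sum _ _ _)); apply/bigmax_leqP => k _.
by rewrite (leq_trans (size_scale_leq _ _))// size_root_quotient.
Qed.

Definition bezoutian y : {poly C} :=
  (q.[y] *: p - p.[y] *: q) %/ ('X - y%:P).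

Lemma bezoutianK y : bezoutian y * ('X - y%:P) = q.[y] *: p - p.[y] *: q.
Proof.
rewrite divpK// dvdp_XsubCl /root hornerD hornerN !hornerZ.
by rewrite [p.[y] * _]mulrC subrr.
Qed.

Lemma size_bezoutian y : (size (bezoutian y) <= d)%N.
Proof.
rewrite size_divp ?polyXsubC_eq0// size_XsubC leq_subLR add1n -size_p.
rewrite (leq_trans (size_polyD _ _))// geq_max size_polyN.
by rewrite !(leq_trans (size_scale_leq _ _))// ltnW.
Qed.

Lemma bezoutian_diag y : (bezoutian y).[y] = (wronskian p q).[y].
Proof.
have := congr1 (fun P : {poly C} => P^`().[y]) (bezoutianK y).
rewrite derivM derivXsubC mulr1 hornerD hornerM hornerXsubC subrr mulr0 add0r => ->.
rewrite derivB !derivZ /wronskian !hornerD !hornerN !hornerZ !hornerM.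
by rewrite mulrC.
Qed.

Lemma bezoutian_lambda y k :
  (bezoutian y).[lambda k] = q.[lambda k] * (root_quotient k).[y].
Proof.
have [<-|ly] := eqVneq (lambda k) y.
  rewrite bezoutian_diag /wronskian hornerD hornerN !hornerM root_quotient_lambda.
  by rewrite eqxx mul1r (rootP (root_lambda k)) mul0r subr0 mulrC.
have ly0 : lambda k - y != 0 by rewrite subr_eq0.
apply: (mulIf ly0); have := congr1 (horner^~ (lambda k)) (bezoutianK y).
rewrite hornerM hornerXsubC hornerD hornerN !hornerZ (rootP (root_lambda k)) => ->.
have -> : p.[y] = (root_quotient k).[y] * (y - lambda k).
  by rewrite -[in LHS](root_quotientK k) hornerM hornerXsubC.
ring.
Qed.

(** On a fibre of [p / q] the pairs [(p(z), q(z))] are proportional, so the numerator of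
    the Bezoutian vanishes. *)
Lemma bezoutian_fiber w y z : p.[y] = w * q.[y] -> p.[z] = w * q.[z] ->
  (bezoutian y).[z] = (z == y)%:R * (wronskian p q).[y].
Proof.
move=> py pz; have [->|zy] := eqVneq z y; first by rewrite mul1r bezoutian_diag.
have zy0 : z - y != 0 by rewrite subr_eq0.
apply: (mulIf zy0); have := congr1 (horner^~ z) (bezoutianK y).
rewrite hornerM hornerXsubC hornerD hornerN !hornerZ py pz => ->; rewrite !mul0r; ring.
Qed.

(** The removable singularity at [lambda k] cancels, and clearing [q] leaves a multiple of
    the Lagrange basis polynomial at [lambda k]. *)
Lemma deltaE k z : q.[z] != 0 ->
  delta p q (lambda k) z =
  (root_quotient k).[z] * q.[lambda k] / (p^`().[lambda k] * q.[z]).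
Proof.
move=> qz; rewrite /delta; have [->|zl] := eqVneq z (lambda k).
  by rewrite root_quotient_lambda eqxx mul1r divff// mulf_neq0.
have zl0 : z - lambda k != 0 by rewrite subr_eq0.
rewrite derive1_ratfun// (rootP (root_lambda k)) mul0r subr0 /ratfun.
rewrite -[in p.[z]](root_quotientK k) hornerM hornerXsubC.
by field; rewrite qz q_lambda p'_neq0 zl0.
Qed.

Definition dual_delta k : C -> C := ratfun (root_quotient k * q) (wronskian p q).

(** Compare the value at [z] of the Bezoutian at [y] with its Lagrange expansion over the
    roots of [p]. *)
Lemma delta_dual w y z : y \in fiber p q w -> z \in fiber p q w ->
  regular p q y ->
  \sum_k delta p q (lambda k) z * dual_delta k y = (z == y)%:R.
Proof.
move=> yw zw [qy Wy]; have [qz _] := (mem_fiberP size_p size_q coprime_ratfun _ _).1 zw.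
move: yw zw; rewrite !(mem_fiber size_p size_q) => /eqP py /eqP pz.
have := bezoutian_fiber py pz.
rewrite {1}(lagrange_interpolation (size_bezoutian y)) horner_sum => bez.
transitivity (q.[y] / (q.[z] * (wronskian p q).[y]) *
    \sum_k (((bezoutian y).[lambda k] / p^`().[lambda k]) *: root_quotient k).[z]).
  rewrite mulr_sumr; apply: eq_bigr => k _.
  rewrite deltaE// hornerZ bezoutian_lambda /dual_delta /ratfun hornerM.
  by field; rewrite qz Wy p'_neq0.
rewrite bez; have [->|_] := eqVneq z y; last by rewrite mul0r mulr0.
by field; rewrite qy Wy.
Qed.

Lemma trace_dual_represents w phi z :
  (forall y, y \in fiber p q w -> regular p q y) -> z \in fiber p q w ->
  phi z = \sum_k delta p q (lambda k) z *
                 trace p q (fun y => phi y * dual_delta k y) w.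
Proof.
move=> reg zw; have Uw := uniq_fiber size_p size_q reg.
transitivity (\sum_(y <- fiber p q w) phi y * (z == y)%:R).
  rewrite (bigD1_seq z)//= eqxx mulr1 big1 ?addr0// => y yz.
  by rewrite eq_sym (negPf yz) mulr0.
under [RHS]eq_bigr do rewrite /trace mulr_sumr.
rewrite exchange_big; apply: eq_big_seq => y yw.
rewrite -(delta_dual yw zw (reg _ yw)) mulr_sumr.
by apply: eq_bigr => k _; rewrite mulrCA.
Qed.

(** On the fibre, [delta_dual] says that the matrix of the [dual_delta k] is a right
    inverse of the square matrix of the [delta k]; so it is a left inverse as well. *)
Lemma trace_dual_unique w phi (g : 'rV[C]_d) :
  (forall y, y \in fiber p q w -> regular p q y) ->
  (forall z, z \in fiber p q w ->
     phi z = \sum_k delta p q (lambda k) z * g ord0 k) ->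
  forall k, g ord0 k = trace p q (fun y => phi y * dual_delta k y) w.
Proof.
move=> reg gE k; have Uw := uniq_fiber size_p size_q reg.
have sw := size_fiber size_p size_q w.
pose z (j : 'I_d) := nth 0 (fiber p q w) j.
have zw j : z j \in fiber p q w by rewrite mem_nth// sw.
pose Delta := \matrix_(j < d, k < d) delta p q (lambda k) (z j).
pose Dual := \matrix_(k < d, j < d) dual_delta k (z j).
have : Delta *m Dual = 1%:M.
  apply/matrixP => i j; rewrite !mxE.
  under eq_bigr do rewrite !mxE.
  rewrite (delta_dual (zw j) (zw i) (reg _ (zw j))).
  by rewrite nth_uniq ?sw.
move=> /mulmx1C/(congr1 (fun A => (A *m g^T) k ord0)).
rewrite mul1mx [RHS]mxE => <-; rewrite -mulmxA mxE /trace (big_nth 0) sw big_mkord.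
apply: eq_bigr => j _; rewrite (gE _ (zw j)) mulrC !mxE; congr (_ * _).
by apply: eq_bigr => i _; rewrite !mxE.
Qed.

End Duality.

(** * The representation theorem *)

Lemma cvg_row (C : numClosedFieldType) d T (F : set_system T) {FF : Filter F}
    (f : T -> 'rV[C]_d) (v : 'rV[C]_d) :
  (forall k, f t ord0 k @[t --> F] --> v ord0 k) -> f @ F --> v.
Proof.
move=> fv A [P Pv sPA].
have : \forall t \near F, forall k, P ord0 k (f t ord0 k).
  by apply: filter_forall => k; exact: (fv k).
by apply: filterS => t Pt; apply: sPA => i k; rewrite ord1.
Qed.

Theorem proposition3p1 (R : realType) (d : nat) (p q : {poly Cplx R})
    (lambda : 'I_d -> Cplx R)
    (deg_p : size p = d.+1)
    (lambda_inj : injective lambda)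
    (lambda_simple_root : forall k, mup (lambda k) p = 1%N)
    (deg_q : (size q < size p)%N)
    (q_lambda : forall k, q.[lambda k] != 0)
    (M : set (Cplx R)) (M_compact : compact M)
    (phi : Cplx R -> Cplx R) :
  let r := ratfun p q in
  let M0 := M `\` critical_values p q in
  let K0 := ratpreim p q M0 in
  let represents (f : Cplx R -> 'rV[Cplx R]_d) :=
    forall z, K0 z ->
      phi z = \sum_(k < d) delta p q (lambda k) z * f (r z) ord0 k in
  exists f : Cplx R -> 'rV[Cplx R]_d,
    [/\ represents f,
        forall g, represents g -> forall w, M0 w -> g w = f w,
        {within K0, continuous phi} -> {within M0, continuous f},
        in_nbhd (@holomorphic_on (Cplx R)) K0 phi ->
          forall k, in_nbhd (@holomorphic_on (Cplx R)) M0
                      (fun w => f w ord0 k)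
      & (forall n, in_nbhd (@Cn (Cplx R) n) K0 phi ->
          forall k, in_nbhd (@Cn (Cplx R) n) M0 (fun w => f w ord0 k))
        /\ (in_nbhd (@Cinfty (Cplx R)) K0 phi ->
          forall k, in_nbhd (@Cinfty (Cplx R)) M0 (fun w => f w ord0 k))].
Proof.
move=> r M0 K0 represents.
have copq := coprime_ratfun deg_p lambda_inj lambda_simple_root q_lambda.
have reg : M0 `<=` fiber_sub p q (regular p q).
  by move=> w [_ wc]; exact: (noncritical_fiber deg_p deg_q copq).
have fiberP w z := mem_fiberP deg_p deg_q copq w z.
have W0 z : regular p q z -> (wronskian p q).[z] != 0 by case.
exists (fun w => \row_k trace p q (fun z => phi z * dual_delta p q lambda k z) w).
have rowE k : (fun w => (\row_k trace p q
    (fun z => phi z * dual_delta p q lambda k z) w : 'rV_d) ord0 k) =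
  trace p q (fun z => phi z * dual_delta p q lambda k z).
  by apply/funext => w; rewrite mxE.
split.
- move=> z [qz rz]; have zw : z \in fiber p q (r z) by apply/fiberP.
  rewrite [LHS](trace_dual_represents deg_p deg_q lambda_inj lambda_simple_root
    q_lambda phi (reg _ rz) zw).
  by apply: eq_bigr => k _; rewrite mxE.
- move=> g gE w Mw; apply/rowP => k; rewrite mxE.
  apply: (trace_dual_unique deg_p deg_q lambda_inj lambda_simple_root q_lambda
    (reg _ Mw)) => z /fiberP[qz rz].
  have Kz : K0 z by split; rewrite // rz.
  by rewrite (gE z Kz) /r rz.
- move=> /subspace_continuousP cphi; apply/subspace_continuousP => w Mw.
  apply: cvg_row => k; rewrite rowE mxE.
  apply: (trace_cvg deg_p deg_q copq (reg _ Mw)) => z zw.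
  have [qz rz] := (fiberP w z).1 zw.
  have [_ Wz] := reg _ Mw z zw.
  apply: cvgM; first by apply: cphi; split; rewrite // rz.
  have cdual := @ratfun_continuous _ (root_quotient p lambda k * q) _ _ Wz.
  move=> P /cdual; exact: (@cvg_within _ (nbhs z)).
- move=> hphi k; rewrite rowE.
  refine (in_nbhd_trace deg_p deg_q copq (P := @holomorphic_on _) _ _ _ _ reg hphi).
  + by move=> U V g UV gV z /UV; exact: gV.
  + by move=> U g h; exact: holomorphic_onM.
  + by move=> U h; exact: (holomorphic_on_trace deg_p deg_q copq).
  + exact: holomorphic_on_ratfun W0.
split=> [n|] hphi k; rewrite rowE.
- refine (in_nbhd_trace deg_p deg_q copq (P := @Cn _ n) _ _ _ _ reg hphi).
  + by move=> U V g; exact: sub_Cn.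
  + by move=> U g h; exact: CnM.
  + by move=> U h; exact: (Cn_trace deg_p deg_q copq).
  + exact: Cn_ratfun W0.
- refine (in_nbhd_trace deg_p deg_q copq (P := @Cinfty _) _ _ _ _ reg hphi).
  + by move=> U V g UV gV n; exact: sub_Cn UV (gV n).
  + by move=> U g h gU hU n; exact: CnM.
  + by move=> U h Ureg hU n; exact: (Cn_trace deg_p deg_q copq).
  + by move=> n; exact: Cn_ratfun W0.
Qed.
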